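(* Consider a Markov decision process $(r,\Gamma,\beta,P)$ with state space $\mathsf X$ and action space $\mathsf A$ satisfying the standing assumptions described in the context, and let $\sigma\in\Sigma$. If $P_\sigma$ is strongly irreducible, then the following three statements are equivalent: (E1) there exists $x\in\mathsf X$ such that $v_s(x)\le v_\sigma(x)$ for all $s\in\Sigma$; (E2) there exists a Borel probability measure $\rho$ on $\mathsf X$ such that $\int v_s\,\mathrm d\rho\le\int v_\sigma\,\mathrm d\rho$ for all $s\in\Sigma$; (E3) $\sigma$ is an optimal policy, i.e. $v_\sigma(x)=v^*(x)$ for all $x\in\mathsf X$.
   Context: $\mathsf X$ and $\mathsf A$ are metric spaces; $b\mathsf X$ is the Banach space of bounded Borel measurable functions $\mathsf X\to\mathbb R$ with the supremum norm and the pointwise order, $b\mathsf X_+$ its nonnegative elements, $cb\mathsf X$ the continuous elements; $b\mathsf X'$ is the (norm) dual of $b\mathsf X$ and $b\mathsf X'_+$ the set of positive functionals ($\mu(f)\ge0$ whenever $f\ge0$). A Markov decision process is a tuple $(r,\Gamma,\beta,P)$ where: $\beta\in(0,1)$; $\Gamma$ is a nonempty, compact-valued, continuous correspondence from $\mathsf X$ to $\mathsf A$; with $\mathsf G=\{(x,a): a\in\Gamma(x)\}$, $r:\mathsf G\to\mathbb R$ is bounded and continuous; for each $(x,a)\in\mathsf G$, $P(x,a,\cdot)$ is a Borel probability measure on $\mathsf X$, and $(x,a)\mapsto\int v(x')P(x,a,\mathrm dx')$ is continuous on $\mathsf G$ for every $v\in cb\mathsf X$. $\Sigma$ is the set of Borel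 measurable $\sigma:\mathsf X\to\mathsf A$ with $\sigma(x)\in\Gamma(x)$ for all $x$. For $\sigma\in\Sigma$, $r_\sigma(x)=r(x,\sigma(x))$, $P_\sigma(x,\mathrm dx')=P(x,\sigma(x),\mathrm dx')$ with Markov operator $(P_\sigma f)(x)=\int f(x')P_\sigma(x,\mathrm dx')$ on $b\mathsf X$, and $v_\sigma=\sum_{t\ge0}(\beta P_\sigma)^t r_\sigma$ (the unique fixed point in $b\mathsf X$ of $v\mapsto r_\sigma+\beta P_\sigma v$). The value function is $v^*(x)=\sup_{s\in\Sigma}v_s(x)$; $\sigma$ is optimal if $v_\sigma=v^*$ on $\mathsf X$. An ideal of $b\mathsf X$ is a linear subspace $I$ such that $f\in I$ and $|g|\le|f|$ imply $g\in I$; it is invariant for a linear operator $K$ if $KI\subset I$. A positive linear operator $K$ on $b\mathsf X$ is irreducible if its only invariant ideals are $\{0\}$ and $b\mathsf X$; equivalently (a standard fact), for every nonzero $f\in b\mathsf X_+$ and every nonzero $\mu\in b\mathsf X'_+$ there is $m\in\mathbb N=\{1,2,\dots\}$ with $\mu(K^m f)>0$. A transition kernel on $\mathsf X$ is strongly irreducible if its Markov operator $f\mapsto\int f(x')Q(x,\mathrm dx')$ is irreducible on $b\mathsf X$ in this sense. *)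

(* Defs.v *)
From HB Require Import structures.
From mathcomp Require Import all_boot all_order all_algebra.
From mathcomp Require Import all_classical all_reals all_analysis.
Set Implicit Arguments. Unset Strict Implicit. Unset Printing Implicit Defensive.
Import Order.TTheory GRing.Theory Num.Theory.
Import numFieldNormedType.Exports.
Local Open Scope classical_set_scope.
Local Open Scope ring_scope.

Definition borel (T : ptopologicalType) := g_sigma_algebraType (@open T).

Definition upper_hemicontinuous (X A : topologicalType) (Gam : X -> set A) :=
  forall x (V : set A), open V -> Gam x `<=` V ->
    exists2 U : set X, nbhs x U & forall y, U y -> Gam y `<=` V.
Definition lower_hemicontinuous (X A : topologicalType) (Gam : X -> set A) :=
  forall x (V : set A), open V -> Gam x `&` V !=set0 ->
    exists2 U : set X, nbhs x U & forall y, U y -> Gam y `&` V !=set0.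
Definition continuous_corr (X A : topologicalType) (Gam : X -> set A) :=
  upper_hemicontinuous Gam /\ lower_hemicontinuous Gam.

Definition graph_corr (X A : Type) (Gam : X -> set A) : set (X * A) :=
  [set p | Gam p.1 p.2].

Section MDP.
Context {R : realType} {X A : pseudoPMetricType R}.

Definition bX (f : X -> R) : Prop :=
  measurable_fun setT (f : borel X -> R) /\ exists M : R, forall x, `|f x| <= M.

Definition cbX (f : X -> R) : Prop := bX f /\ continuous f.

Definition policies (Gam : X -> set A) : set (X -> A) :=
  [set s | measurable_fun setT (s : borel X -> borel A) /\ forall x, Gam x (s x)].

Definition Pop (P : X * A -> probability (borel X) R) (s : X -> A)
  (f : X -> R) : X -> R :=
  fun x => fine (\int[P (x, s x)]_y (f y)%:E)%E.

Definition vpol (r : X * A -> R) (beta : R) (P : X * A -> probability (borel X) R)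
  (s : X -> A) : X -> R :=
  fun x => limn (series (fun t : nat =>
     beta ^+ t * iter t (Pop P s) (fun y => r (y, s y)) x)).

Definition vstar (Gam : X -> set A) (r : X * A -> R) (beta : R)
  (P : X * A -> probability (borel X) R) : X -> R :=
  fun x => sup [set vpol r beta P s x | s in policies Gam].

Definition ideal_bX (I : set (X -> R)) : Prop :=
  [/\ I `<=` bX, I (fun=> 0),
      (forall f g, I f -> I g -> I (f \+ g)),
      (forall (c : R) f, I f -> I (fun x => c * f x)) &
      (forall f g, I f -> bX g -> (forall x, `|g x| <= `|f x|) -> I g)].

Definition invariant_ideal (K : (X -> R) -> (X -> R)) (I : set (X -> R)) :=
  forall f, I f -> I (K f).

Definition irreducible (K : (X -> R) -> (X -> R)) : Prop :=
  forall I, ideal_bX I -> invariant_ideal K I -> I = [set fun=> 0] \/ I = bX.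

Definition strongly_irreducible (P : X * A -> probability (borel X) R)
  (s : X -> A) : Prop := irreducible (Pop P s).

Definition MDP (r : X * A -> R) (Gam : X -> set A) (beta : R)
  (P : X * A -> probability (borel X) R) : Prop :=
  [/\ 0 < beta < 1,
      (forall x, Gam x !=set0) /\ (forall x, compact (Gam x)),
      continuous_corr Gam,
      (exists M : R, forall p, graph_corr Gam p -> `|r p| <= M)
        /\ {within graph_corr Gam, continuous r} &
      (forall v, cbX v ->
         {within graph_corr Gam,
           continuous (fun p => fine (\int[P p]_y (v y)%:E)%E)})].

End MDP.

(* Main.v *)
Require Import Defs.
From HB Require Import structures.
From mathcomp Require Import all_boot all_order all_algebra finmap.
From mathcomp Require Import all_classical all_reals all_analysis.
From mathcomp Require Import wochoice measurable_realfun ring lra.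
Import Order.TTheory GRing.Theory Num.Theory.
Import numFieldNormedType.Exports.
Local Open Scope classical_set_scope.
Local Open Scope ring_scope.
Set Implicit Arguments. Unset Strict Implicit. Unset Printing Implicit Defensive.

(**
  Existence of an optimal policy is not needed. Suppose sigma maximises the
  rho-mean of the value, and let s be any policy. Using s wherever it improves
  on v_sigma in one step, and sigma elsewhere, gives a policy s_0 whose value
  exceeds v_sigma by some w >= 0 and dominates the one-step return of s.
  Switching back to sigma wherever this improves, n times, gives a policy whose
  value exceeds v_sigma by at least (beta P_sigma)^n w. So P_sigma^n w has zero
  rho-mean for all n, irreducibility forces w = 0, and s does not improve on
  v_sigma.

  Measurability is the real issue, since neither space is assumed separable.
  If P_sigma preserves bX, then irreducibility applied to indicators of
  singletons makes every state an atom of some P_sigma^n(x0, .), so X is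
  countable and every subset of X is Borel.

  To see that P_sigma preserves bX, one needs x |-> g (x, sigma x) to be Borel
  for g continuous on the graph of Gam. Cover A by countably many discrete
  families of small open sets C_a. By compactness and upper hemicontinuity the
  preimages E_a of the C_a form a locally finite family all of whose unions are
  Borel. A Delta-system argument bounds the Borel classes of the E_a, which
  allows arbitrarily many of them to be glued along a locally constant index.
*)

(** * Well-orderings and a substitute for the first uncountable ordinal *)

Lemma exists_strict_well_order (T : eqType) : exists lt : T -> T -> Prop,
  [/\ well_founded lt, forall x y z, lt x y -> lt y z -> lt x z &
      forall x y, [\/ lt x y, x = y | lt y x]].
Proof.
have [R Rwo] := well_ordering_principle T.
have Rtot x y : R x y || R y x.
  have [|z [[]]] := Rwo (pred2 x y); first by exists x; rewrite inE eqxx.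
  rewrite !inE => /orP[] /eqP -> zlow _.
    by rewrite zlow// inE eqxx orbT.
  by rewrite orbC zlow// inE eqxx.
have Ranti x y : R x y -> R y x -> x = y.
  move=> xy yx; have Rwo' : wo_chain R predT by move=> B _; exact: Rwo.
  by apply: (wo_chain_antisymmetric Rwo'); rewrite ?inE// xy yx.
have Rtr x y z : R x y -> R y z -> R x z.
  move=> xy yz.
  have [|t [[]]] := Rwo (pred3 x y z); first by exists x; rewrite inE eqxx.
  rewrite !inE => /or3P[] /eqP -> tlow _.
  - by rewrite tlow// !inE eqxx !orbT.
  - have <- : y = x by apply: Ranti => //; apply: tlow; rewrite !inE eqxx.
    by [].
  - have zx : R z x by apply: tlow; rewrite !inE eqxx.
    have zy : R z y by apply: tlow; rewrite !inE eqxx orbT.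
    by rewrite -(Ranti _ _ yz zy).
exists (fun x y => R x y /\ x <> y); split.
- move=> x; apply: contrapT => nx.
  have [|z [[zA zlow] _]] := Rwo (fun y => `[< ~ Acc (fun x y => R x y /\ x <> y) y >]).
    by exists x; apply/asboolP.
  move: zA => /asboolP; apply; constructor => y [yz ynz].
  apply: contrapT => ny; apply: ynz; apply: Ranti => //.
  by apply: zlow; apply/asboolP.
- move=> x y z [xy nxy] [yz nyz]; split; first exact: Rtr yz.
  by move=> xz; apply: nxy; apply: Ranti => //; rewrite xz.
- move=> x y; have [->|/eqP xy] := eqVneq x y; first by constructor 2.
  have /orP[|] := Rtot x y; first by constructor 1.
  by constructor 3; split => // yx; apply: xy.
Qed.

Lemma uncountable_natbool : ~ countable [set: nat -> bool].
Proof.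
move=> /countable_injP[f finj].
pose d n := `[< exists2 g : nat -> bool, f g = n & ~~ g n >].
have : d (f d) = ~~ d (f d).
  apply/idP/idP => [/asboolP[g /finj gd]|nd].
    by rewrite gd ?inE.
  by apply/asboolP; exists d.
by case: (d (f d)).
Qed.

(** What is used of the first uncountable ordinal: recursion over countable initial segments, and
    uncountable cofinality ([o1_ub]). It will index Borel classes. *)
Record omega1_like (W : Type) (lt : W -> W -> Prop) : Prop := {
  o1_inh : inhabited W;
  o1_wf : well_founded lt;
  o1_trans : forall x y z, lt x y -> lt y z -> lt x z;
  o1_total : forall x y, [\/ lt x y, x = y | lt y x];
  o1_countable : forall w, countable [set u | lt u w];
  o1_ub : forall u : nat -> W, exists w, forall n, lt (u n) w }.

(** In a well-ordered uncountable set, take the points with countable initial segment. Were they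
    countably many, a least point outside would itself have a countable initial segment. A sequence
    without strict bound would cover them by countably many countable sets. *)
Lemma exists_omega1_like : exists W lt, @omega1_like W lt.
Proof.
have [lt [wf tr tot]] := exists_strict_well_order (nat -> bool).
pose V := [set w | countable [set u | lt u w]].
have Vdown u w : lt u w -> V w -> V u.
  move=> uw; apply: sub_countable; apply: subset_card_le => t /= tu; exact: tr uw.
have Vunc : ~ countable V.
  move=> Vc.
  have [w nVw] : exists w, ~ V w.
    apply/existsNP => VT; apply: uncountable_natbool; apply: sub_countable Vc.
    by apply: subset_card_le => w _; exact: VT.
  elim: {w}(wf w) nVw => w _ IH; apply; apply: sub_countable Vc.
  by apply: subset_card_le => u uw; apply: contrapT; exact: IH.
exists {x | V x}, (fun x y => lt (sval x) (sval y)); split.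
- have [w Vw] : exists w, V w.
    apply: contrapT => /forallNP V0; apply: Vunc; apply: sub_countable (@countable0 nat).
    by rewrite (_ : V = set0) ?card_le_emptyl//; apply/seteqP; split=> w // /V0.
  by constructor; exists w.
- move=> [x Vx]; elim: (wf x) Vx => {}x _ IH Vx.
  by constructor => -[y Vy] /= yx; exact: IH.
- by move=> x y z; exact: tr.
- move=> [x Vx] [y Vy]; case: (tot x y) => [xy|xy|xy].
  + by constructor 1.
  + by constructor 2; subst y; congr exist; exact: Prop_irrelevance.
  + by constructor 3.
- move=> [w Vw] /=; have /countable_injP[f finj] := Vw.
  apply/countable_injP; exists (f \o sval).
  move=> [x Vx] [y Vy]; rewrite !inE/= => xw yw fxy.
  have xy : x = y by apply: finj; rewrite ?inE.
  by subst y; congr exist; exact: Prop_irrelevance.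
- move=> u; apply: contrapT => /forallNP nub; apply: Vunc.
  apply: (@sub_countable _ _ _ (\bigcup_(p in [set: nat * bool])
      (if p.2 then [set x | lt x (sval (u p.1))] else [set sval (u p.1)]))).
    apply: subset_card_le => w Vw.
    have /existsNP[n nlt] := nub (exist _ w Vw).
    by have [wn|wn|/nlt//] := tot w (sval (u n)); [exists (n, true)|exists (n, false)].
  apply: bigcup_countable => // -[n []] _ /=; last exact: countable1.
  exact: (svalP (u n)).
Qed.

(** * The Delta-system argument *)

Section Sunflower.
Variables (W : Type) (lt : W -> W -> Prop) (Wo : omega1_like lt).
Variables (I : choiceType) (f : {fset I} -> I) (b : W -> {fset I} -> Prop).
Hypothesis bW : forall u w D, lt u w -> b u D -> b w D.
Hypothesis bE : forall D, exists w, b w D.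

(** Read [b w D] as: [D] has complexity at most [w]. Since sequences in [W] have upper bounds, the
    bounded families form a sigma-ideal. *)
Let bdd (Q : set {fset I}) := exists w, Q `<=` b w.

Let bddS Q Q' : Q `<=` Q' -> bdd Q' -> bdd Q.
Proof. by move=> QQ' [w Qw]; exists w; exact: subset_trans Qw. Qed.

Let bdd_cup (Q : nat -> set {fset I}) : (forall n, bdd (Q n)) -> bdd (\bigcup_n Q n).
Proof.
move=> /choice[u uQ]; have [w uw] := o1_ub Wo u.
by exists w => D [n _ /uQ/bW]; apply.
Qed.

Let bdd0 : bdd set0.
Proof. by have [w _] := bE fset0; exists w. Qed.

Let bdd_ctble J (C : set J) (Q : J -> set {fset I}) :
  countable C -> (forall i, C i -> bdd (Q i)) -> bdd (\bigcup_(i in C) Q i).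
Proof.
move=> /countable_injP[e einj] bQ.
apply: (@bddS _ (\bigcup_n \bigcup_(i in [set i | C i /\ e i = n]) Q i)).
  by move=> D [i Ci QD]; exists (e i) => //; exists i.
apply: bdd_cup => n.
have [[i [Ci ein]]|nex] := pselect (exists i, C i /\ e i = n).
  apply: bddS (bQ _ Ci) => D [j [Cj ejn]]; suff -> : j = i by [].
  by apply: einj; rewrite ?inE// ejn.
by apply: bddS bdd0 => D [j Cj]; case: nex; exists j.
Qed.

(* A Delta-system argument: an unbounded family would contain an
   omega_1-sequence of sets, pairwise disjoint off a common kernel, whose
   chosen points f D are isolated by a single set T. *)
Lemma sunflower_bounded n :
  (forall T : set I, bdd [set D | f D \in D /\ forall i, i \in D -> (T i <-> i = f D)]) ->
  bdd [set D | f D \in D /\ #|` D| = n].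
Proof.
move=> hT; apply: contrapT => nb.
pose Q (c : {fset I}) := [set D | [/\ f D \in D, #|` D| = n & (c `<=` D)%fset]].
(* The kernel [c]: the sets containing it form an unbounded family, but a bounded one after any
   point is added. Enlarging [c] must stop, as no [D] with [n] elements contains [n.+1] points. *)
have [c [ubc cmax]] : exists c, ~ bdd (Q c) /\
    forall i, i \notin c -> bdd (Q (i |` c)%fset).
  apply: contrapT => /forallNP noc.
  have : forall k, exists c, ~ bdd (Q c) /\ #|` c| = k.
    elim=> [|k [c [ubc ck]]].
      exists fset0; split => //; apply: contra_not nb; apply: bddS => D [fD Dn].
      by split => //; exact: fsub0set.
    apply: contrapT => nk; apply: (noc c); split => // i ic.
    apply: contrapT => ubi; apply: nk; exists (i |` c)%fset; split => //.
    by rewrite cardfsU1 ic ck.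
  move=> /(_ n.+1)[c [ubc cn]]; apply: ubc; apply: bddS bdd0 => D [_ Dn cD].
  by have := fsubset_leq_card cD; rewrite cn Dn ltnn.
pose Q' := [set D | Q c D /\ f D \notin c].
(* For each [i] in the finite kernel, the sets with [f D = i] are isolated by the singleton of [i],
   hence bounded. *)
have ubQ' : ~ bdd Q'.
  apply: contra_not ubc => bQ'.
  apply: (@bddS _ (\bigcup_k (if k == 0%N then Q' else
      \bigcup_(i in [set` c]) [set D | Q c D /\ f D = i]))).
    move=> D QD; have [fDc|fDc] := boolP (f D \in c).
      by exists 1%N => //=; exists (f D).
    by exists 0%N.
  apply: bdd_cup => -[//|k] /=; apply: bdd_ctble; first exact: countable_fset.
  move=> i ic; apply: bddS (hT [set i]) => D [[fD _ cD] fDi]; split => //.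
  by move=> j jD; rewrite fDi.
have [w0 _] := bE fset0.
(* By maximality of the kernel, the sets meeting a countable [C] off the kernel form a bounded
   family, so some set beyond [w] avoids [C]. *)
have step w (C : set I) : countable C -> (forall i, C i -> i \notin c) ->
    exists D, [/\ Q' D, ~ b w D & forall i, i \in D -> ~ C i].
  move=> Cc Cn; apply: contrapT => /forallNP no; apply: ubQ'.
  apply: (@bddS _ (\bigcup_k (if k == 0%N then b w else
      \bigcup_(i in C) Q (i |` c)%fset))).
    move=> D Q'D; have [bD|nbD] := pselect (b w D); first by exists 0%N.
    exists 1%N => //=; apply: contrapT => nD; apply: (no D); split => // i iD Ci.
    apply: nD; exists i => //; case: Q'D => -[fD Dn cD] _; split => //.
    by rewrite fsubUset fsub1set iD.
  apply: bdd_cup => -[|k]; first by exists w.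
  by apply: bdd_ctble => // i Ci; apply: cmax; exact: Cn.
(* Points off the kernel used at earlier stages. Avoiding them makes the sets [G w] below pairwise
   disjoint off [c]; by [step] the default [fset0] is never taken. *)
pose C w (G : forall u, lt u w -> {fset I}) : set I :=
  [set i | i \notin c /\ exists u (uw : lt u w), i \in G u uw].
pose F w (G : forall u, lt u w -> {fset I}) : {fset I} :=
  xget fset0 [set D | [/\ Q' D, ~ b w D & forall i, i \in D -> ~ C w G i]].
pose G := Fix (o1_wf Wo) (fun=> {fset I}) F.
have GE w : G w = F w (fun u _ => G u).
  rewrite /G Fix_eq// => w' g h gh; congr (F w' _).
  by apply: functional_extensionality_dep => u;
     apply: functional_extensionality_dep => uw.
have GP w : [/\ Q' (G w), ~ b w (G w) &
    forall i, i \in G w -> ~ C w (fun u _ => G u) i].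
  rewrite GE /F; case: xgetP => [D -> //|no].
  have [||D HD] := step w (C w (fun u _ => G u)); last by case: (no D).
    apply: (@sub_countable _ _ _ (\bigcup_(u in [set u | lt u w]) [set` G u])).
      by apply: subset_card_le => i [ic [u [uw iu]]]; exists u.
    by apply: bigcup_countable; [exact: o1_countable|move=> u _; exact: countable_fset].
  by move=> i [].
have Gdisj u w i : i \in G u -> i \in G w -> i \notin c -> u = w.
  move=> iu iw ic; case: (o1_total Wo u w) => // uw.
    by have [_ _ /(_ i iw)] := GP w; case; split => //; exists u, uw.
  by have [_ _ /(_ i iu)] := GP u; case; split => //; exists w, uw.
(* This [T] meets every [G u] in [f (G u)] only. The bound it receives is some [w], yet [G w] was
   chosen outside [b w]. *)
have [w wP] := hT [set f (G w) | w in setT].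
have [[[fG _ _] fc] nb' _] := GP w; apply: nb'; apply: wP; split => //.
move=> i iG; split => [[u _ fui]|->]; last by exists w.
have [[[fGu _ _] fcu] _ _] := GP u.
by rewrite -fui; congr (f (G _)); apply: (@Gdisj _ _ i); rewrite -?fui// fui.
Qed.

End Sunflower.

Lemma countable_bigcup_measurable d (T : measurableType d) J (C : set J)
    (F : J -> set T) : countable C -> (forall i, C i -> measurable (F i)) ->
  measurable (\bigcup_(i in C) F i).
Proof.
move=> /countable_injP[e einj] mF.
have -> : \bigcup_(i in C) F i = \bigcup_n \bigcup_(i in [set i | C i /\ e i = n]) F i.
  apply/seteqP; split=> [x [i Ci Fx]|x [n _ [i [Ci _] Fx]]]; last by exists i.
  by exists (e i) => //; exists i.
apply: bigcup_measurable => n _.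
have [[i [Ci ein]]|nex] := pselect (exists i, C i /\ e i = n).
  rewrite (_ : \bigcup_(_ in _) _ = F i); first exact: mF.
  apply/seteqP; split=> [x [j [Cj ejn]]|x Fx]; last by exists i.
  suff -> : j = i by [].
  by apply: einj; rewrite ?inE// ejn.
rewrite (_ : \bigcup_(_ in _) _ = set0)//.
by apply/seteqP; split=> x // [j Cj _]; case: nex; exists j.
Qed.

Lemma open_borel (X : ptopologicalType) (U : set X) :
  open U -> measurable (U : set (borel X)).
Proof. by move=> oU; exact: sub_sigma_algebra. Qed.

(** * Borel classes and gluing along a locally constant index *)

Section BorelHierarchy.
Variables (W : Type) (lt : W -> W -> Prop) (Wo : omega1_like lt).

(** The additive Borel hierarchy. Open sets are put into every level, so that the levels increase
    even where open sets are not F-sigma. *)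
Inductive borel_class (X : topologicalType) : W -> set X -> Prop :=
| borel_class_open w U : open U -> borel_class w U
| borel_class_cup w (F : nat -> set X) (u : nat -> W) :
    (forall n, lt (u n) w) -> (forall n, borel_class (u n) (F n)) ->
    borel_class w (\bigcup_n ~` F n).

Lemma borel_class_mono (X : topologicalType) u w (E : set X) :
  lt u w -> borel_class u E -> borel_class w E.
Proof.
move=> uw uE; case: uE uw => {E}u => [E oE _|F v vu vF uw].
  exact: borel_class_open.
by apply: (borel_class_cup (u := v)) => // n; exact: o1_trans uw.
Qed.

Lemma borel_classC (X : topologicalType) u w (E : set X) :
  lt u w -> borel_class u E -> borel_class w (~` E).
Proof.
move=> uw uE; rewrite (_ : ~` E = \bigcup_(n : nat) ~` E).
  exact: (@borel_class_cup _ _ (fun=> E) (fun=> u)).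
by apply/seteqP; split=> [x nEx|x []//]; exists 0%N.
Qed.

Lemma borel_class_exists (X : ptopologicalType) (E : set X) :
  measurable (E : set (borel X)) -> exists w, borel_class w E.
Proof.
have gt w : exists w', lt w w' by have [w' ww'] := o1_ub Wo (fun=> w); exists w'; exact: ww' 0%N.
have [w0] := o1_inh Wo.
apply: (@smallest_sub _ _ _ (fun E : set X => exists w, borel_class w E)).
  split.
  - by exists w0; apply: borel_class_open; exact: open0.
  - move=> F [w wF]; have [w' ww'] := gt w; exists w'; rewrite setTD.
    exact: borel_classC wF.
  - move=> F /choice[u uF]; have [w uw] := o1_ub Wo u; have [w' ww'] := gt w.
    exists w'; rewrite (_ : \bigcup_k F k = \bigcup_k ~` (~` F k)).
      apply: (borel_class_cup (u := fun=> w)) => // n; exact: borel_classC (uF n).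
    by apply: eq_bigcup => // k _; rewrite setCK.
by move=> U oU; exists w0; exact: borel_class_open.
Qed.

Section Gluing.
Variables (X : ptopologicalType) (I : Type) (S : X -> I) (Z : set X).
Hypothesis mZ : measurable (Z : set (borel X)).
Hypothesis ZS : forall x, Z x -> \forall y \near x, Z y -> S y = S x.

(** Since [S] is locally constant on [Z], the glued set is relatively open in [Z]. *)
Lemma measurable_glue_open (F : I -> set X) : (forall D, open (F D)) ->
  measurable ([set x | Z x /\ F (S x) x] : set (borel X)).
Proof.
move=> oF; rewrite (_ : mkset _ = Z `&` [set y | Z y -> F (S y) y]^°).
  by apply: measurableI => //; apply: open_borel; exact: open_interior.
apply/seteqP; split=> [x [Zx Fx]|x [Zx]]; last first.
  by move=> /interior_subset /= /(_ Zx).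
split => //; have Fxn : nbhs x (F (S x)) by exact: open_nbhs_nbhs.
by near=> y => Zy; rewrite (near (ZS Zx) y _)//; near: y.
Unshelve. all: by end_near. Qed.

(** Induction on the common class [w]. The classes of the pieces of [F D] vary with [D], but only
    countably many lie below [w], so the pieces can be sorted by class and each sort glued
    separately. *)
Lemma measurable_glue w (F : I -> set X) : (forall D, borel_class w (F D)) ->
  measurable ([set x | Z x /\ F (S x) x] : set (borel X)).
Proof.
elim: {w}(o1_wf Wo w) F => w _ IH F wF.
(* The boolean tells whether [F D] is taken as open; otherwise the sequences of sets and of their
   classes follow. *)
have /choice[p pP] : forall D, exists p : bool * (nat -> set X) * (nat -> W),
    if p.1.1 then open (F D) else
    [/\ forall n, lt (p.2 n) w, forall n, borel_class (p.2 n) (p.1.2 n) &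
        F D = \bigcup_n ~` p.1.2 n].
  move=> D; case: (wF D) => {}w' => [U oU|G u uw uG].
    by exists (true, fun=> setT, fun=> w').
  by exists (false, G, u).
pose F0 D := if (p D).1.1 then F D else set0.
(* Where the [k]-th piece does not have class [v], the filler [setT] contributes nothing, because
   complements are taken next. *)
pose H k v D := if pselect ((p D).1.1 = false /\ (p D).2 k = v) then (p D).1.2 k else setT.
rewrite (_ : mkset _ = [set x | Z x /\ F0 (S x) x] `|`
   \bigcup_k \bigcup_(v in [set v | lt v w]) (Z `\` [set x | Z x /\ H k v (S x) x])).
  apply: measurableU.
    apply: measurable_glue_open => D; rewrite /F0.
    by have := pP D; case: (p D).1.1 => // _; exact: open0.
  apply: bigcup_measurable => k _.
  apply: countable_bigcup_measurable; first exact: o1_countable.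
  move=> v vw; apply: measurableD => //; apply: (IH v vw) => D.
  rewrite /H; case: pselect => [[pD pv]|_]/=; last by apply: borel_class_open; exact: openT.
  by rewrite -pv; have := pP D; rewrite pD => -[].
apply/seteqP; split=> [x [Zx]|x [[Zx]|[k _ [v vw [Zx]]]]].
- rewrite /F0; have := pP (S x); case pD: (p (S x)).1.1.
    by move=> _ Fx; left; rewrite /= pD.
  move=> [lw _ ->] [k _ nGx]; right; exists k => //; exists ((p (S x)).2 k) => //.
  by split => //= -[_]; rewrite /H; case: pselect => /= [?|[]].
- by rewrite /F0; have := pP (S x); case: (p (S x)).1.1.
- move=> /= /not_andP[//|]; rewrite /H; case: pselect => //= -[pD _] nG.
  split => //; have := pP (S x); rewrite pD => -[_ _ ->].
  by exists k.
Qed.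

End Gluing.
End BorelHierarchy.

(** Where [S x] has exactly [n] elements, upper semicontinuity makes [S] locally constant. There the
    union is taken over the positions [j] in an enumeration of [S x], and each term is glued. The
    Delta-system argument supplies the common Borel class. *)
Lemma measurable_bigcup_upper_semicontinuous (X : ptopologicalType)
    (I : pointedType) (S : X -> {fset I}) (E B : I -> set X) :
  (forall x, \forall y \near x, (S y `<=` S x)%fset) ->
  (forall i x, E i x -> i \in S x) ->
  (forall T : set I, measurable (\bigcup_(i in T) E i : set (borel X))) ->
  (forall i, open (B i)) ->
  measurable (\bigcup_i (B i `&` E i) : set (borel X)).
Proof.
move=> Susc ES mE oB; have [W [lt Wo]] := exists_omega1_like.
pose Z n := [set x | #|` S x| = n].
have oS n : open [set x | (#|` S x| < n)%N].
  rewrite openE => x /= xn; rewrite /interior; near=> y.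
  by apply: leq_ltn_trans xn; apply: fsubset_leq_card; near: y; exact: Susc.
have mZ n : measurable (Z n : set (borel X)).
  rewrite (_ : Z n = [set x | (#|` S x| < n.+1)%N] `\` [set x | (#|` S x| < n)%N]).
    by apply: measurableD; exact: open_borel.
  apply/seteqP; split=> x /=; rewrite /Z/=.
    by move=> ->; rewrite ltnS leqnn ltnn.
  by move=> [xn /negP]; rewrite -leqNgt => nx; apply/eqP; rewrite eqn_leq nx -ltnS xn.
have ZS n x : Z n x -> \forall y \near x, Z n y -> S y = S x.
  move=> Zx; near=> y => Zy; apply/eqP; rewrite eqEfcard.
  suff -> : (S y `<=` S x)%fset by rewrite /= (Zx : _ = n) (Zy : _ = n).
  by near: y; exact: Susc.
pose f j (D : {fset I}) := nth point D j.
have -> : \bigcup_i (B i `&` E i) = \bigcup_n \bigcup_(j in [set j | (j < n)%N])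
    ([set x | Z n x /\ B (f j (S x)) x] `&` [set x | Z n x /\ E (f j (S x)) x]).
  apply/seteqP; split=> [x [i _ [Bx Ex]]|x [n _ [j jn [[_ Bx] [_ Ex]]]]]; last first.
    by exists (f j (S x)).
  have iS := ES _ _ Ex.
  exists #|` S x| => //; exists (index i (S x)); first by rewrite /= index_mem.
  by rewrite /setI/= /f nth_index.
apply: bigcup_measurable => n _; apply: bigcup_measurable => j /= jn.
apply: measurableI; first exact:
  (@measurable_glue_open _ _ S (Z n) (mZ n) (ZS n) (fun D => B (f j D))).
(* Agreement is asked only where [S x = D], so that one Borel set can serve many [D] at once. *)
pose b w D := exists2 F, borel_class lt w F & forall x, S x = D -> (F x <-> E (f j D) x).
have [||T|w wP] := @sunflower_bounded _ _ Wo _ (f j) b _ _ n.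
- by move=> u w D uw [F uF FE]; exists F => //; exact: borel_class_mono uF.
- move=> D; have [w wE] := borel_class_exists Wo (mE [set f j D]).
  by exists w; exists (E (f j D)); rewrite ?bigcup_set1 in wE *.
(* If [f j D] is the only element of [D] in [T], the union over [T] coincides with [E (f j D)] where
   [S x = D]. So the class of this one union bounds all such [D]. *)
- have [w wE] := borel_class_exists Wo (mE T).
  exists w => D [fD DT]; exists (\bigcup_(i in T) E i) => // x xD; split.
    by move=> [i Ti Ex]; have := ES _ _ Ex; rewrite xD => /DT[/(_ Ti) <-].
  by move=> Ex; exists (f j D) => //; apply/DT.
have /choice[F FP] : forall D, exists F, borel_class lt w F /\
    (f j D \in D -> #|` D| = n -> forall x, S x = D -> (F x <-> E (f j D) x)).
  move=> D; have [[fD Dn]|nD] := pselect (f j D \in D /\ #|` D| = n).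
    by have [|F wF FE] := wP D; [split|exists F].
  by exists set0; split=> [|fD Dn]; [apply: borel_class_open; exact: open0|case: nD].
rewrite (_ : [set x | _ /\ E _ _] = [set x | Z n x /\ F (S x) x]).
  by apply: (@measurable_glue _ _ Wo _ _ S (Z n) (mZ n) (ZS n) w F) => D; have [] := FP D.
have fS x : Z n x -> f j (S x) \in S x by move=> Zx; rewrite /f mem_nth// Zx.
by apply/seteqP; split=> x [Zx] ?; split => //; apply/((FP (S x)).2 (fS x Zx) Zx x).
Unshelve. all: by end_near. Qed.

(** * Sigma-discrete covers of a metric space *)

Lemma exists_natSinv_lt (R : realType) (e : R) : 0 < e -> exists n, n.+1%:R^-1 < e.
Proof.
by move=> e0; have [n _ /(_ n (leqnn n)) ne] := near_infty_natSinv_lt (PosNum e0); exists n.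
Qed.

(* A. H. Stone's construction: assign each point to the first ball, in a
   well-ordering of the centres, that contains it. *)
Lemma sigma_discrete_cover (R : realType) (A : pseudoMetricType R) (e : R) :
  0 < e -> exists C : nat -> A -> set A,
  [/\ forall n a, open (C n a), forall n a, C n a `<=` ball a e,
      forall n, exists2 d : R, 0 < d & forall a b x y,
        C n a x -> C n b y -> ball x d y -> a = b &
      forall x, exists n a, C n a x].
Proof.
move=> e0; have [lt [wf _ tot]] := exists_strict_well_order A.
pose dl n : R := n.+1%:R^-1.
have dl0 n : 0 < dl n by rewrite invr_gt0.
pose F n a := [set z | ball z (dl n) `<=` (ball a e)^° /\
  forall b, lt b a -> ~ (ball b e)^° z].
(* Points of [F n a] and [F n b] with distinct centres are never [dl n]-close. Thickening by a third
   makes the sets open and leaves a gap of a third. *)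
pose C n a := \bigcup_(z in F n a) (ball z (dl n / 3))^°.
have dl3 n : dl n / 3 <= dl n by have := dl0 n; lra.
have Fsep n a b z w : F n a z -> F n b w -> ball z (dl n) w -> a = b.
  move=> [za zn] [wb wn] zw; case: (tot a b) => // ab.
    by case: (wn _ ab); exact: za.
  by case: (zn _ ab); apply: wb; exact: ball_sym.
exists C; split.
- by move=> n a; apply: bigcup_open => z _; exact: open_interior.
- move=> n a x [z [za _] /interior_subset zx].
  exact: interior_subset (za _ (le_ball (dl3 n) zx)).
- move=> n; exists (dl n / 3); first by rewrite divr_gt0.
  move=> a b x y [z Fz /interior_subset zx] [w Fw /interior_subset wy] xy.
  apply: (Fsep n _ _ z w) => //.
  have -> : dl n = dl n / 3 + dl n / 3 + dl n / 3 by lra.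
  by apply: ball_triangle (ball_sym wy); exact: ball_triangle xy.
- move=> x.
  have [a xa amin] : exists2 a, (ball a e)^° x & forall b, lt b a -> ~ (ball b e)^° x.
    apply: contrapT => /forall2NP no.
    have nx a : ~ (ball a e)^° x.
      elim: {a}(wf a) => a _ IH xa; case: (no a) => [/(_ xa)//|/existsNP[b]].
      by move=> /not_implyP[ba /contrapT]; exact: IH ba.
    by apply: (nx x); exact: nbhsx_ballx.
  have /nbhs_ballP[d /= d0 dxa] : nbhs x (ball a e)^° by exact: nbhs_interior.
  have [n nd] : exists n, dl n < d.
    exact: exists_natSinv_lt.
  exists n, a, x; last by apply: nbhsx_ballx; rewrite divr_gt0.
  by split => // y xy; apply: dxa; exact: (le_ball (ltW nd)).
Qed.

(** * Borel measurability along a selector *)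

Section Selector.
Variables (R : realType) (X : ptopologicalType) (A : pseudoPMetricType R).
Variables (Gam : X -> set A) (s : X -> A).
Hypothesis Gcomp : forall x, compact (Gam x).
Hypothesis Guhc : upper_hemicontinuous Gam.
Hypothesis ms : measurable_fun setT (s : borel X -> borel A).
Hypothesis sG : forall x, Gam x (s x).

(** The preimages of a uniformly discrete family are locally finite, and any union of them is the
    preimage of an open set, hence Borel. *)
Lemma measurable_selector_discrete (C : A -> set A) (B : A -> set X) (d : R) :
  0 < d -> (forall a, open (C a)) ->
  (forall a b x y, C a x -> C b y -> ball x d y -> a = b) ->
  (forall a, open (B a)) ->
  measurable (\bigcup_a (B a `&` s @^-1` (C a)) : set (borel X)).
Proof.
move=> d0 oC Csep oB; pose E a := s @^-1` (C a).
(* Finitely many balls of radius [d / 2] cover [Gam x], each meets at most one [C a], and upper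
   hemicontinuity keeps nearby values inside their union. *)
have lfin (x : X) : exists2 J : set A, finite_set J &
    \forall y \near x, forall a, E a y -> J a.
  have := @Gcomp x; rewrite compact_cover.
  move=> /(_ _ setT (fun p => (ball p (d / 2))^°))[].
  - by move=> p _; exact: open_interior.
  - by move=> p _; exists p => //; apply: nbhsx_ballx; rewrite divr_gt0.
  move=> D _ GD.
  exists (\bigcup_(p in [set` D]) [set a | C a `&` ball p (d / 2) !=set0]).
    apply: bigcup_finite; first exact: finite_fset.
    move=> p _; have [[a [x' [Cx px]]]|no] :=
        pselect (exists a, C a `&` ball p (d / 2) !=set0).
      apply: (sub_finite_set _ (finite_set1 a)) => b [y [Cy py]] /=.
      apply: (Csep _ _ y x') => //; exact: (ball_split (ball_sym py) px).
    by apply: (sub_finite_set _ (finite_set0 A)) => b Hb; case: no; exists b.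
  have [|U xU GU] := Guhc (x := x) _ GD.
    by apply: bigcup_open => p _; exact: open_interior.
  apply: filterS xU => y /GU Gy a Ey; have [p pD /interior_subset py] := Gy _ (sG y).
  by exists p => //; exists (s y).
(* Closures make the index set upper semicontinuous: finitely many closed sets missing [x] miss a
   neighbourhood of [x]. *)
pose S0 x := [set a | closure (E a) x].
have clJ (J : set A) (x : X) : (\forall y \near x, forall a, E a y -> J a) -> S0 x `<=` J.
  by move=> xJ a /(_ _ xJ)[y [Ey]]; exact.
have S0fin x : finite_set (S0 x).
  by have [J fJ xJ] := lfin x; apply: sub_finite_set fJ; exact: clJ.
pose S x : {fset A} := fset_set (S0 x).
have inS x a : a \in S x <-> S0 x a by rewrite in_fset_set// inE.
apply: (@measurable_bigcup_upper_semicontinuous X A S E B) => //.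
- move=> x; have [J fJ xJ] := lfin x.
  pose J' := fset_set (J `\` S0 x).
  have fJ' : finite_set (J `\` S0 x) by exact: finite_setD.
  have : nbhs x (\bigcap_(a in [set` J']) ~` closure (E a)).
    apply: filter_bigI => a; rewrite in_fset_set// inE => -[_ nSa].
    by apply: open_nbhs_nbhs; split => //; apply: closed_openC; exact: closed_closure.
  have := nbhs_interior xJ; apply: filterS2 => y yJ yJ'.
  apply/fsubsetP => a /inS Sya; apply/inS; apply: contrapT => nSxa.
  apply: (yJ' a) => //=; rewrite in_fset_set// inE; split => //.
  exact: clJ yJ _ Sya.
- by move=> a x Ex; apply/inS; exact: subset_closure.
- move=> T; rewrite (_ : bigcup _ _ = s @^-1` (\bigcup_(i in T) C i)) ?preimage_bigcup//.
  have mC : measurable (\bigcup_(i in T) C i : set (borel A)).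
    by apply: open_borel; apply: bigcup_open => a _.
  by have := ms measurableT mC; rewrite setTI.
Qed.

(** Near [(x, s x)] continuity keeps [g] above [c] on the part of a rectangle inside the graph. Its
    second side may be taken from countably many discrete families, its first side is then an open
    set. *)
Lemma measurable_fun_selector (g : X * A -> R) :
  {within graph_corr Gam, continuous g} ->
  measurable_fun setT ((fun x => g (x, s x)) : borel X -> R).
Proof.
move=> gc; apply: (measurability _ (RGenOInfty.measurableE R)) => //.
move=> _ [_ [c ->] <-]; rewrite setTI.
have /choice[C CP] (k : nat) := @sigma_discrete_cover R A k.+1%:R^-1 ltac:(by rewrite invr_gt0).
pose B k n a := [set x | forall b, C k n a b -> Gam x b -> c < g (x, b)]^°.
rewrite (_ : _ @^-1` _ = \bigcup_k \bigcup_n \bigcup_a (B k n a `&` s @^-1` (C k n a))).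
  apply: bigcup_measurable => k _; apply: bigcup_measurable => n _.
  have [oC _ /(_ n)[d d0 Csep] _] := CP k.
  by apply: (@measurable_selector_discrete _ _ d) => // a; exact: open_interior.
apply/seteqP; split=> x /=; last first.
  move=> [k _ [n _ [a _ [/interior_subset /= Bx Cx]]]].
  by rewrite in_itv/= andbT; exact: Bx.
rewrite in_itv/= andbT => cg.
have /subspace_continuousP/(_ (x, s x) (sG x)) gx := gc.
have : nbhs (g (x, s x)) [set y | c < y] by exact: lt_nbhsr.
move=> /gx; rewrite /= nbhs_simpl /within/=.
move=> [[U V] /= [xU /nbhs_ballP[e /= e0 sV]] UV].
(* Points of [C k n a] are within [e / 2] of [a], hence within [e] of each other. *)
have [k ke] : exists k, k.+1%:R^-1 < e / 2 :> R.
  by apply: exists_natSinv_lt; rewrite divr_gt0.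
have [_ Cball _ /(_ (s x))[n [a Ca]]] := CP k.
exists k => //; exists n => //; exists a => //; split => //.
apply: filterS xU => y Uy b Cb Gb; apply: (UV (y, b)) => //; split => //=.
apply: sV; have -> : e = e / 2 + e / 2 by lra.
apply: (le_ball (lerD (ltW ke) (ltW ke))).
exact: ball_triangle (ball_sym (Cball _ _ _ Ca)) (Cball _ _ _ Cb).
Qed.
End Selector.

(** * From continuous test functions to bounded Borel functions *)

Lemma continuous_borel_measurable (R : realType) (X : ptopologicalType) (f : X -> R) :
  continuous f -> measurable_fun setT (f : borel X -> R).
Proof.
move=> cf; apply: (measurability _ (RGenOInfty.measurableE R)) => //.
move=> _ [_ [c ->] <-]; rewrite setTI; apply: open_borel.
have /continuousP := cf; apply; rewrite set_itvE; exact: open_gt.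
Qed.

Lemma open_indicator_approx (R : realType) (X : pseudoPMetricType R) (U : set X) :
  open U -> exists u : nat -> X -> R,
  [/\ forall n, continuous (u n), forall n x, 0 <= u n x <= 1 &
      forall x, u ^~ x @ \oo --> (\1_U x : R)].
Proof.
(* The sets [G n] exhaust [U] and keep a uniform distance from its complement, so Urysohn functions
   separate them. *)
move=> oU; pose G n := [set x | ball x (n.+1%:R^-1 : R) `<=` U].
have sepG n : uniform_separator (~` U) (G n).
  have n0 : 0 < n.+1%:R^-1 :> R by rewrite invr_gt0.
  apply: (@uniform_separatorW X).
  exists [set xy | ball xy.1 (n.+1%:R^-1 : R) xy.2]; 
    first exact: (@entourage_ball R X (PosNum n0)).
  by apply/seteqP; split=> // -[x y] [[/= nUx Gy] xy]; apply: nUx; apply: Gy; exact: ball_sym.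
exists (fun n => Urysohn (~` U) (G n)); split.
- by move=> n; exact: Urysohn_continuous.
- move=> n x; have /(_ (Urysohn (~` U) (G n) x)) := @Urysohn_range _ R (~` U) (G n).
  by rewrite /= in_itv/=; apply; exists x.
- move=> x; have [Ux|nUx] := pselect (U x); last first.
    rewrite indicE memNset// (_ : (fun n => _) = cst 0); first exact: cvg_cst.
    apply/funext => n; have := @Urysohn_sub0 _ R _ _ (sepG n); apply.
    by exists x.
  rewrite indicE mem_set//; apply: cvg_near_cst.
  have /nbhs_ballP[e /= e0 eU] : nbhs x U by exact: open_nbhs_nbhs.
  have := near_infty_natSinv_lt (PosNum e0); apply: filterS => n /= ne.
  have := @Urysohn_sub1 _ R _ _ (sepG n); apply; exists x => //.
  by move=> y xy; apply: eU; exact: (le_ball (ltW ne)).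
Qed.

Section Integral.
Variables (R : realType) (X : pseudoPMetricType R).
Implicit Types (mu : probability (borel X) R) (f g : X -> R).

Lemma bX_integrable mu f : bX f -> mu.-integrable setT (EFin \o (f : borel X -> R)).
Proof.
move=> [mf [M Mf]]; apply: measurable_bounded_integrable => //.
  by apply: (le_lt_trans _ (ltry 1)); exact: probability_le1.
by exists M; split => [|c Mc x _]; [exact: num_real|exact: le_trans (ltW Mc)].
Qed.

Lemma bX_cst (c : R) : bX (fun _ : X => c).
Proof. by split; [exact: measurable_cst|exists `|c|]. Qed.

Lemma bX_add f g : bX f -> bX g -> bX (f \+ g).
Proof.
move=> [mf [M Mf]] [mg [N Ng]]; split; first exact: measurable_funD.
by exists (M + N) => x; rewrite (le_trans (ler_normD _ _))// lerD.
Qed.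

Lemma bX_scale (c : R) f : bX f -> bX (fun x => c * f x).
Proof.
move=> [mf [M Mf]]; split; first exact: measurable_funM.
by exists (`|c| * M) => x; rewrite normrM ler_wpM2l.
Qed.

Lemma bX_sub f g : bX f -> bX g -> bX (f \- g).
Proof.
move=> bf bg; rewrite (_ : f \- g = f \+ (fun x => -1 * g x)).
  by apply: bX_add => //; exact: bX_scale.
by apply/funext => x /=; rewrite mulN1r.
Qed.

Lemma bX_abs f : bX f -> bX (fun x => `|f x|).
Proof.
move=> [mf [M Mf]]; split; first exact: measurableT_comp.
by exists M => x; rewrite normr_id.
Qed.

Definition mean mu f : R := fine (\int[mu]_x (f x)%:E)%E.

Lemma meanD mu f g : bX f -> bX g -> mean mu (f \+ g) = mean mu f + mean mu g.
Proof. by move=> bf bg; apply: RintegralD => //; exact: bX_integrable. Qed.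

Lemma meanZ mu (c : R) f : bX f -> mean mu (fun x => c * f x) = c * mean mu f.
Proof. by move=> bf; apply: RintegralZl => //; exact: bX_integrable. Qed.

Lemma mean_le mu f g : bX f -> bX g -> (forall x, f x <= g x) -> mean mu f <= mean mu g.
Proof.
by move=> bf bg fg; apply: le_Rintegral => //; exact: bX_integrable.
Qed.

Lemma mean_cst mu (c : R) : mean mu (fun=> c) = c.
Proof. by rewrite /mean integral_cst//= [X in (_ * X)%E]probability_setT mule1. Qed.

Lemma mean_fin mu f : bX f -> (\int[mu]_x (f x)%:E = (mean mu f)%:E)%E.
Proof. by move=> bf; rewrite fineK//; apply: integrable_fin_num => //; exact: bX_integrable. Qed.

End Integral.

Section FellerSelector.
Variables (R : realType) (X : pseudoPMetricType R) (k : X -> probability (borel X) R).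
Hypothesis kc : forall v, cbX v -> measurable_fun setT ((fun x => mean (k x) v) : borel X -> R).

Lemma measurable_kernel_open (U : set X) : open U ->
  measurable_fun setT ((fun x => k x U) : borel X -> \bar R).
Proof.
move=> oU; have [u [uc u01 uU]] := @open_indicator_approx R X U oU.
have bu n : bX (u n).
  split; first exact: continuous_borel_measurable.
  by exists 1 => x; have /andP[u0 u1] := u01 n x; rewrite ger0_norm.
apply: (@emeasurable_fun_cvg _ (borel X) R setT
  (fun n x => (mean (k x) (u n))%:E) (fun x => k x U)) => [n|x _].
  by apply/measurable_EFinP; exact: kc.
have mU : measurable (U : set (borel X)) by exact: open_borel.
rewrite -[X in k x X]setIT -(integral_indic (k x))//.
under eq_fun do rewrite -mean_fin//.
have [] := @dominated_convergence _ (borel X) R (k x) setT measurableT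
  (fun n y => (u n y)%:E) (fun y => (\1_U y)%:E) (cst 1%E).
- by move=> n; apply/measurable_EFinP; exact: (bu n).1.
- by apply/measurable_EFinP; exact: measurable_indic.
- by apply: nearW => y _; apply: cvg_EFin; [exact: nearW|exact: uU].
- by apply: (bX_integrable (k x) (bX_cst _ 1)).
- by apply: nearW => y n _; rewrite lee_fin; have /andP[u0 u1] := u01 n y; rewrite ger0_norm.
- by [].
Qed.

(** Open sets form a pi-system generating the Borel sets, and the property passes to complements and
    disjoint unions. *)
Lemma measurable_kernel (U : set (borel X)) : measurable U ->
  measurable_fun setT ((fun x => k x U) : borel X -> \bar R).
Proof.
move=> mU; move: U mU; apply: (@dynkin_induction _ (borel X) (@open X)
  (fun U => measurable_fun setT ((fun x => k x U) : borel X -> \bar R))).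
- by [].
- by move=> U V; exact: openI.
- under eq_fun do rewrite probability_setT; exact: measurable_cst.
- by move=> U; exact: measurable_kernel_open.
- move=> S mS mkS; under eq_fun do rewrite probability_setC//.
  by apply: emeasurable_funB => //; exact: measurable_cst.
- move=> F mF tF mkF.
  have mcF : measurable (\bigcup_n F n) by exact: bigcup_measurable.
  under eq_fun do rewrite measure_semi_bigcup//.
  exact: (@ge0_emeasurable_sum _ (borel X) R setT (fun i x => k x (F i)) xpredT).
Qed.

Lemma measurable_mean f : bX f -> measurable_fun setT ((fun x => mean (k x) f) : borel X -> R).
Proof.
move=> [mf _]; apply: measurableT_comp => //.
under eq_fun do rewrite integralE.
have mf' : measurable_fun setT (EFin \o (f : borel X -> R)) by exact/measurable_EFinP.
apply: emeasurable_funB.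
- apply: (@measurable_fun_integral_kernel _ _ (borel X) (borel X) R k) => //.
    by move=> U; exact: measurable_kernel.
  exact: measurable_funepos.
- apply: (@measurable_fun_integral_kernel _ _ (borel X) (borel X) R k) => //.
    by move=> U; exact: measurable_kernel.
  exact: measurable_funeneg.
Qed.

End FellerSelector.

(** * Markov operators and irreducibility *)

Section Markov.
Variables (R : realType) (X : pseudoPMetricType R).
Implicit Types (f g h : X -> R) (K : (X -> R) -> X -> R).

Record markov_operator K : Prop := {
  markov_bX : forall f, bX f -> bX (K f);
  markovD : forall f g, bX f -> bX g -> K (f \+ g) = K f \+ K g;
  markovZ : forall (c : R) f, bX f -> K (fun x => c * f x) = (fun x => c * K f x);
  markov_le : forall f g, bX f -> bX g -> (forall x, f x <= g x) ->
    forall x, K f x <= K g x;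
  markov1 : K (fun=> 1) = (fun=> 1) }.

Lemma markov_cst K (c : R) : markov_operator K -> K (fun=> c) = (fun=> c).
Proof.
move=> mK; rewrite (_ : (fun=> c) = (fun=> c * 1)) ?(markovZ mK) ?(markov1 mK)//.
  exact: bX_cst.
by apply/funext => x; rewrite mulr1.
Qed.

Lemma markovB K f g : markov_operator K -> bX f -> bX g ->
  K (f \- g) = K f \- K g.
Proof.
move=> mK bf bg; have E h h' : h \- h' = h \+ (fun x => -1 * h' x).
  by apply/funext => x /=; rewrite mulN1r.
by rewrite !E (markovD mK) ?(markovZ mK)//; exact: bX_scale.
Qed.

Lemma markov_abs K f : markov_operator K -> bX f ->
  forall x, `|K f x| <= K (fun y => `|f y|) x.
Proof.
move=> mK bf x; have ba := bX_abs bf.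
rewrite ler_norml; apply/andP; split; last by apply: markov_le => // y; exact: ler_norm.
rewrite -mulN1r -[_ * _](congr1 (@^~ x) (markovZ mK (-1) ba)).
by apply: markov_le => //; [exact: bX_scale|move=> y; rewrite mulN1r lerNl -normrN ler_norm].
Qed.

Lemma markov_bound K f (M : R) : markov_operator K -> bX f ->
  (forall x, `|f x| <= M) -> forall x, `|K f x| <= M.
Proof.
move=> mK bf fM x; apply: le_trans (markov_abs mK bf x) _.
rewrite -[leRHS](congr1 (@^~ x) (markov_cst M mK)).
by apply: markov_le => //; [exact: bX_abs|exact: bX_cst].
Qed.

Lemma markov_iter K n : markov_operator K -> markov_operator (iter n K).
Proof.
move=> mK; elim: n => [|n IH]; first by split.
split.
- by move=> f bf; apply: (markov_bX mK); exact: (markov_bX IH).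
- move=> f g bf bg; rewrite !iterS (markovD IH)// (markovD mK)//; exact: (markov_bX IH).
- move=> c f bf; rewrite !iterS (markovZ IH)// (markovZ mK)//; exact: (markov_bX IH).
- move=> f g bf bg fg; apply: (markov_le mK); try exact: (markov_bX IH).
  exact: (markov_le IH).
- by rewrite iterS (markov1 IH) (markov1 mK).
Qed.

(* The functions killed in mean by all powers of K form a K-invariant ideal. *)
Lemma irreducible_eq0 K (mu : probability (borel X) R) f :
  markov_operator K -> irreducible K -> bX f -> (forall x, 0 <= f x) ->
  (forall n, mean mu (iter n K f) = 0) -> f = fun=> 0.
Proof.
move=> mK irrK bf f0 muf.
have mKn n := markov_iter n mK.
have ge0 n h : bX h -> (forall x, 0 <= h x) -> 0 <= mean mu (iter n K h).
  move=> bh h0; rewrite -(mean_cst mu 0) -(markov_cst 0 (mKn n)).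
  have b0 := @bX_cst R X 0.
  apply: mean_le; try exact: (markov_bX (mKn n)).
  exact: (markov_le (mKn n)).
have squeeze n g h : bX g -> bX h -> (forall x, 0 <= g x <= h x) ->
    mean mu (iter n K h) = 0 -> mean mu (iter n K g) = 0.
  move=> bg bh gh h0; apply/eqP; rewrite eq_le ge0// ?andbT => [|x].
    rewrite -h0; apply: mean_le; try exact: (markov_bX (mKn n)).
    by apply: (markov_le (mKn n)) => // x; have /andP[] := gh x.
  by have /andP[] := gh x.
pose I := [set g | bX g /\ forall n, mean mu (iter n K (fun x => `|g x|)) = 0].
have If : I f.
  by split=> // n; rewrite (_ : (fun x => _) = f)//; apply/funext => x; rewrite ger0_norm.
have [||I0|IT] := irrK I.
- split.
  + by move=> g [].
  + split; first exact: bX_cst.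
    move=> n; rewrite (_ : (fun x => _) = fun=> 0).
      by rewrite (markov_cst 0 (mKn n)) mean_cst.
    by apply/funext => x; rewrite normr0.
  + move=> g h [bg g0] [bh h0]; split; first exact: bX_add.
    have [ag ah] := (bX_abs bg, bX_abs bh).
    move=> n; apply: (@squeeze _ _ ((fun x => `|g x|) \+ (fun x => `|h x|))).
    * by apply: bX_abs; exact: bX_add.
    * exact: bX_add.
    * by move=> x; rewrite normr_ge0 ler_normD.
    * rewrite (markovD (mKn n))// meanD ?g0 ?h0 ?addr0//; exact: (markov_bX (mKn n)).
  + move=> c g [bg g0]; split; first exact: bX_scale.
    move=> n; rewrite (_ : (fun x => _) = fun x => `|c| * `|g x|).
      rewrite (markovZ (mKn n)) ?meanZ ?g0 ?mulr0//; try exact: bX_abs.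
      by apply: (markov_bX (mKn n)); exact: bX_abs.
    by apply/funext => x; rewrite normrM.
  + move=> g h [bg g0] bh hg; split => // n.
    by apply: squeeze (g0 n); try exact: bX_abs; move=> x; rewrite normr_ge0 hg.
(* Invariance: [|K g| <= K |g|] shifts the exponent from [n] to [n.+1]. *)
- move=> g [bg g0]; split; first exact: (markov_bX mK).
  move=> n; have := g0 n.+1; rewrite iterSr; apply: squeeze.
  + by apply: bX_abs; exact: (markov_bX mK).
  + by apply: (markov_bX mK); exact: bX_abs.
  + by move=> x; rewrite normr_ge0 markov_abs.
- by move: If; rewrite I0.
- have : I (fun=> 1) by rewrite IT; exact: bX_cst.
  move=> [_ /(_ 0%N)] /=; rewrite (_ : (fun x => _) = fun=> 1).
    by rewrite mean_cst => /eqP; rewrite oner_eq0.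
  by apply/funext => x; rewrite normr1.
Qed.

(** The numbers [a n y] are the masses of the atoms [y] after [n] steps from [point]. For each [n]
    only finitely many exceed a given level, and a state massless at every [n] would have zero
    indicator. *)
Lemma irreducible_countable K : markov_operator K -> irreducible K ->
  (forall x : X, measurable ([set x] : set (borel X))) -> countable [set: X].
Proof.
move=> mK irrK m1; pose mu : probability (borel X) R := \d_(point : borel X).
have mKn n := markov_iter n mK.
pose e (y x : X) : R := \1_[set y] x.
have be y : bX (e y).
  split; first exact: measurable_indic.
  by exists 1 => x; rewrite /e indicE; case: (_ \in _); rewrite ?normr1 ?normr0.
pose a n y := mean mu (iter n K (e y)).
have aE n (s : seq X) : bX (fun x => \sum_(y <- s) e y x) /\
    \sum_(y <- s) a n y = mean mu (iter n K (fun x => \sum_(y <- s) e y x)).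
  elim: s => [|y s [bs IH]].
    under eq_fun do rewrite big_nil.
    by rewrite big_nil (markov_cst 0 (mKn n)) mean_cst; split => //; exact: bX_cst.
  have -> : (fun x => \sum_(z <- y :: s) e z x) = e y \+ (fun x => \sum_(z <- s) e z x).
    by apply/funext => x; rewrite big_cons.
  split; first exact: bX_add.
  by rewrite big_cons IH (markovD (mKn n))// meanD//; exact: (markov_bX (mKn n)).
have sum_e (s : seq X) x : uniq s -> \sum_(y <- s) e y x = (x \in s)%:R.
  elim: s => [|y s IH] /=; first by rewrite big_nil.
  move=> /andP[ys us]; rewrite big_cons IH// in_cons /e indicE.
  have [->|xy] := eqVneq x y; first by rewrite mem_set// (negPf ys) addr0.
  by rewrite memNset ?add0r//=; exact/eqP.
have sum_a n (s : seq X) : uniq s -> \sum_(y <- s) a n y <= 1.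
  move=> us; have [bs ->] := aE n s; rewrite -[leRHS](mean_cst mu 1).
  rewrite -(markov1 (mKn n)); have b1 := @bX_cst R X 1.
  apply: mean_le; try exact: (markov_bX (mKn n)).
  by apply: (markov_le (mKn n)) => // x; rewrite sum_e//; case: (_ \in _).
apply: (@sub_countable _ _ _ (\bigcup_n \bigcup_k [set y | k.+1%:R^-1 < a n y])).
  apply: subset_card_le => y _; apply: contrapT => ny.
  have : e y = fun=> 0.
    apply: (@irreducible_eq0 K mu) => // n.
    apply/eqP; rewrite eq_le; apply/andP; split.
      rewrite leNgt; apply/negP => /exists_natSinv_lt[k ka].
      by apply: ny; exists n => //; exists k.
    rewrite -[leLHS](mean_cst mu 0) -(markov_cst 0 (mKn n)).
    have b0 := @bX_cst R X 0; apply: mean_le; try exact: (markov_bX (mKn n)).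
    by apply: (markov_le (mKn n)) => // x; rewrite /e indicE.
  move=> /(congr1 (@^~ y)); rewrite /e indicE mem_set// => /eqP.
  by rewrite oner_eq0.
apply: bigcup_countable => // n _; apply: bigcup_countable => // k _.
(* With [k.+2] states of mass above [k.+1%:R^-1] the total mass would exceed 1. *)
apply: finite_set_countable; apply: contrapT => /(infinite_set_fset k.+2)[D DS Dk].
have := sum_a n D (fset_uniq D); apply/negP; rewrite -ltNge.
apply: (@lt_le_trans _ _ (\sum_(y <- D) k.+1%:R^-1)).
  rewrite big_const_seq count_predT iter_addr addr0 -[_ *+ _]mulr_natl.
  by rewrite -[ltLHS](@mulfV _ k.+1%:R)// ltr_pM2r// ltr_nat.
by rewrite !big_seq; apply: ler_sum => y /DS /ltW.
Qed.

End Markov.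

(** * The discounted value and its comparison principle *)

Section Value.
Variables (R : realType) (X : pseudoPMetricType R).
Hypothesis bX_all : forall f : X -> R, (exists M, forall x, `|f x| <= M) -> bX f.
Variables (K : (X -> R) -> X -> R) (beta : R) (r : X -> R).
Hypothesis (mK : markov_operator K) (b01 : 0 < beta < 1) (br : bX r).

(** With [K := Pop P s] and the reward along [s], this is [vpol] by conversion. *)
Definition value : X -> R :=
  fun x => limn (series (fun t : nat => beta ^+ t * iter t K r x)).

Let S n x := series (fun t : nat => beta ^+ t * iter t K r x) n.

Let bS n : bX (S n).
Proof.
elim: n => [|n IH].
  by rewrite (_ : S 0 = fun=> 0); [exact: bX_cst|apply/funext => x; rewrite /S /series/= big_geq].
rewrite (_ : S n.+1 = S n \+ (fun x => beta ^+ n * iter n K r x)).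
  by apply: bX_add => //; apply: bX_scale; exact: (markov_bX (markov_iter n mK)).
by apply/funext => x; rewrite /S/= seriesSr.
Qed.

(** The series appends its last term; the fixed-point equation needs the first one split off. *)
Let SS n x : S n.+1 x = r x + beta * K (S n) x.
Proof.
elim: n x => [|n IH] x.
  rewrite (_ : S 0 = fun=> 0) ?(markov_cst 0 mK) ?mulr0 ?addr0.
    by rewrite /S seriesSr /series/= big_geq// add0r expr0 mul1r.
  by apply/funext => y; rewrite /S /series/= big_geq.
rewrite {1}/S seriesSr -/(S n.+1 x) IH.
have -> : S n.+1 = S n \+ (fun x => beta ^+ n * iter n K r x).
  by apply/funext => y; rewrite /S/= seriesSr.
have bn : bX (iter n K r) by exact: (markov_bX (markov_iter n mK)).
rewrite (markovD mK)//=; last exact: bX_scale.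
rewrite (markovZ mK)// exprS; ring.
Qed.

Lemma geometric_le0 (a C : R) : (forall n, a <= C * beta ^+ n) -> a <= 0.
Proof.
move=> aC; have /andP[b0 b1] := b01.
have cv : (fun n => C * beta ^+ n) @ \oo --> C * 0.
  by apply: cvgM; [exact: cvg_cst|apply: cvg_expr; rewrite ger0_norm// ltW].
rewrite -(mulr0 C); rewrite -(cvg_lim (@Rhausdorff _) cv).
by apply: limr_ge; [exact: cvgP cv|exact: nearW].
Qed.

Lemma value_approx : exists2 C : R, 0 <= C & forall n x, `|value x - S n x| <= C * beta ^+ n.
Proof.
have /andP[b0 b1] := b01; have [_ [M Mr]] := br.
have M0 : 0 <= M by exact: le_trans (Mr point).
have b1' : 0 < 1 - beta by rewrite subr_gt0.
have Mn n x : `|iter n K r x| <= M by exact: (markov_bound (markov_iter n mK)).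
pose C := M / (1 - beta).
have C0 : 0 <= C by rewrite divr_ge0// ltW.
(* The bound is the geometric sum of [M * beta ^+ t] over the block from [n] to [n + k]; keeping the
   factor [1 - beta ^+ k] lets the induction close. *)
have SnK n k x : `|S (n + k)%N x - S n x| <= C * beta ^+ n * (1 - beta ^+ k).
  elim: k => [|k IH]; first by rewrite addn0 subrr normr0 expr0 subrr mulr0.
  rewrite addnS {1}/S seriesSr -/(S (n + k)%N x) addrAC.
  apply: le_trans (ler_normD _ _) _.
  have -> : C * beta ^+ n * (1 - beta ^+ k.+1) =
      C * beta ^+ n * (1 - beta ^+ k) + beta ^+ (n + k) * M.
    rewrite exprD exprS /C; field; exact: lt0r_neq0.
  apply: lerD => //; rewrite normrM ger0_norm ?exprn_ge0 ?(ltW b0)//.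
  by rewrite ler_wpM2l ?exprn_ge0 ?(ltW b0).
have cvS x : cvgn (S ^~ x).
  apply: (@normed_cvg _ _ (fun t => beta ^+ t * iter t K r x)).
  apply: (@series_le_cvg _ _ (fun t => M * beta ^+ t)).
  - by move=> n; exact: normr_ge0.
  - by move=> n; rewrite mulr_ge0// exprn_ge0// ltW.
  - move=> n /=; rewrite normrM ger0_norm ?exprn_ge0 ?(ltW b0)// mulrC.
    by rewrite ler_wpM2r// exprn_ge0// ltW.
  - by apply: is_cvg_geometric_series; rewrite ger0_norm// ltW.
exists C => // n x.
have cvd : (fun k => `|S (k + n)%N x - S n x|) @ \oo --> `|value x - S n x|.
  apply: cvg_norm; apply: cvgB; last exact: cvg_cst.
  by rewrite (cvg_shiftn n (S ^~ x)); exact: cvS.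
rewrite -(cvg_lim (@Rhausdorff _) cvd).
apply: limr_le; first exact: cvgP cvd.
apply: nearW => k; rewrite addnC; apply: le_trans (SnK _ _ _) _.
apply: ler_piMr; first by rewrite mulr_ge0// exprn_ge0// ltW.
by rewrite gerBl exprn_ge0// ltW.
Qed.

Lemma value_bX : bX value.
Proof.
have [C C0 CP] := value_approx; apply: bX_all; exists C => x.
by have := CP 0%N x; rewrite expr0 mulr1 /S /series/= big_geq// subr0.
Qed.

(** The error of the partial sums is uniform in the state, hence preserved by [K]; so the defect is
    at most [2 * C * beta ^+ n] for every [n]. *)
Lemma value_fix x : value x = r x + beta * K value x.
Proof.
have /andP[b0 b1] := b01; have [C C0 CP] := value_approx.
apply/eqP; rewrite -subr_eq0 -normr_le0.
apply: (@geometric_le0 _ (2 * C)) => n.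
have -> : value x - (r x + beta * K value x) =
    (value x - S n.+1 x) + beta * (K (S n) x - K value x) by rewrite SS; ring.
apply: le_trans (ler_normD _ _) _.
have -> : 2 * C * beta ^+ n = C * beta ^+ n + C * beta ^+ n by ring.
have Cn0 : 0 <= C * beta ^+ n by rewrite mulr_ge0// exprn_ge0// ltW.
apply: lerD.
  apply: le_trans (CP _ _) _; rewrite exprS mulrCA ler_piMl//; exact: ltW.
rewrite normrM ger0_norm ?(ltW b0)//.
have : `|K (S n) x - K value x| <= C * beta ^+ n.
  rewrite -[_ - _](congr1 (@^~ x) (markovB mK (bS n) value_bX)).
  apply: markov_bound => //; first exact: bX_sub value_bX.
  by move=> y /=; rewrite distrC.
by move=> le; apply: le_trans (ler_wpM2l (ltW b0) le) _; rewrite ler_piMl// ltW.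
Qed.

(** Iterating the inequality from a bound [N] of [d] gives [d <= N * beta ^+ n]. Applied to
    differences with [value], it compares sub- and supersolutions with the fixed point. *)
Let sub_fix_le0 d : bX d -> (forall x, d x <= beta * K d x) -> forall x, d x <= 0.
Proof.
move=> bd dK x; have /andP[b0 b1] := b01; have [_ [N dN]] := bd.
apply: (@geometric_le0 _ N) => n; elim: n x => [|n IH] x.
  by rewrite expr0 mulr1; apply: le_trans (dN x); exact: ler_norm.
apply: le_trans (dK x) _; rewrite exprS mulrCA ler_wpM2l ?(ltW b0)//.
rewrite -[leRHS](congr1 (@^~ x) (markov_cst (N * beta ^+ n) mK)).
by apply: (markov_le mK) => //; exact: bX_cst.
Qed.

Lemma le_value w : bX w -> (forall x, w x <= r x + beta * K w x) ->
  forall x, w x <= value x.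
Proof.
move=> bw wK x; rewrite -subr_le0; apply: (@sub_fix_le0 (w \- value)).
  exact: bX_sub value_bX.
move=> y; rewrite (markovB mK)//=; last exact: value_bX.
by rewrite value_fix; have := wK y; lra.
Qed.

Lemma ge_value w : bX w -> (forall x, r x + beta * K w x <= w x) ->
  forall x, value x <= w x.
Proof.
move=> bw wK x; rewrite -subr_le0; apply: (@sub_fix_le0 (value \- w)).
  by apply: bX_sub => //; exact: value_bX.
move=> y; rewrite (markovB mK)//=; last exact: value_bX.
by rewrite value_fix; have := wK y; lra.
Qed.

End Value.

Lemma Pop_markov (R : realType) (X A : pseudoPMetricType R)
    (P : X * A -> probability (borel X) R) (s : X -> A) :
  (forall f, bX f -> measurable_fun setT (Pop P s f : borel X -> R)) ->
  markov_operator (Pop P s).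
Proof.
move=> mP; have PE f x : Pop P s f x = mean (P (x, s x)) f by [].
split.
- move=> f bf; split; first exact: mP.
  have [_ [M Mf]] := bf; exists M => x; rewrite PE.
  have fM y : - M <= f y <= M by rewrite -ler_norml.
  rewrite ler_norml; apply/andP; split.
    rewrite -[leLHS](mean_cst (P (x, s x))).
    by apply: mean_le => // [|y]; [exact: bX_cst|have /andP[] := fM y].
  rewrite -[leRHS](mean_cst (P (x, s x))).
  by apply: mean_le => // [|y]; [exact: bX_cst|have /andP[] := fM y].
- by move=> f g bf bg; apply/funext => x; rewrite /= !PE meanD.
- by move=> c f bf; apply/funext => x; rewrite !PE meanZ.
- by move=> f g bf bg fg x; rewrite !PE mean_le.
- by apply/funext => x; rewrite PE mean_cst.
Qed.

(** * Policy switching when every subset of the state space is Borel *)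

Section CountableMDP.
Variables (R : realType) (X A : pseudoPMetricType R).
Variables (r : X * A -> R) (Gam : X -> set A) (beta : R).
Variables (P : X * A -> probability (borel X) R) (sigma : X -> A).
Hypothesis mall : forall S : set X, measurable (S : set (borel X)).
Hypothesis b01 : 0 < beta < 1.
Hypothesis rM : exists M : R, forall p, graph_corr Gam p -> `|r p| <= M.
Hypothesis sigmaP : policies Gam sigma.

Let bX_all (f : X -> R) : (exists M, forall x, `|f x| <= M) -> bX f.
Proof. by move=> fM; split => // _ Y mY; exact: mall. Qed.

Let mP s : markov_operator (Pop P s).
Proof. by apply: Pop_markov => f bf _ Y mY; exact: mall. Qed.

Let br s : policies Gam s -> bX (fun x => r (x, s x)).
Proof.
by move=> [_ sG]; have [M MP] := rM; apply: bX_all; exists M => x; apply: MP; exact: sG.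
Qed.

Let v := vpol r beta P.

Let bv s : policies Gam s -> bX (v s).
Proof. by move=> sG; exact: (value_bX bX_all (mP s) b01 (br sG)). Qed.

Let vE s x : policies Gam s -> v s x = r (x, s x) + beta * Pop P s (v s) x.
Proof. by move=> sG; exact: (value_fix bX_all (mP s) b01 (br sG)). Qed.

(** Policy improvement: choosing the better action state by state makes [v s1] a subsolution for the
    new policy, so its value can only rise. *)
Lemma policy_switch s1 s2 : policies Gam s1 -> policies Gam s2 ->
  exists s, [/\ policies Gam s, forall x, v s1 x <= v s x &
    forall x, r (x, s2 x) + beta * Pop P s2 (v s1) x <= v s x].
Proof.
move=> G1 G2; have /andP[b0 _] := b01.
pose T2 x := r (x, s2 x) + beta * Pop P s2 (v s1) x.
pose s x := if v s1 x < T2 x then s2 x else s1 x.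
have sG : policies Gam s.
  split=> [_ Y mY|x]; first exact: mall.
  by rewrite /s; case: ifP => _; [exact: G2.2|exact: G1.2].
have TsE x : r (x, s x) + beta * Pop P s (v s1) x = Num.max (v s1 x) (T2 x).
  rewrite /Pop /s; case: ltP => [lt12|le21]; first by rewrite -/(T2 x).
  by rewrite [RHS]vE.
have le1 x : v s1 x <= v s x.
  apply: (le_value bX_all (mP s) b01 (br sG)); first exact: bv.
  by move=> y; rewrite TsE le_max lexx.
exists s; split => // x; rewrite -/(T2 x) [leRHS]vE//.
apply: le_trans (_ : r (x, s x) + beta * Pop P s (v s1) x <= _).
  by rewrite TsE le_max lexx orbT.
apply: lerD (lexx _) _; apply: ler_wpM2l (ltW b0) _ _ _.
exact: (markov_le (mP s) (bv G1) (bv sG) le1).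
Qed.

Lemma mean_maximal_dominates (rho : probability (borel X) R) :
  strongly_irreducible P sigma ->
  (forall s, policies Gam s -> mean rho (v s) <= mean rho (v sigma)) ->
  forall s, policies Gam s -> forall x, v s x <= v sigma x.
Proof.
move=> irr rhomax s sG; have /andP[b0 _] := b01.
have mPn n := markov_iter n (mP sigma).
have [s0 [s0G s0ge s0T]] := policy_switch sigmaP sG.
pose w := v s0 \- v sigma.
have bw : bX w by apply: bX_sub; exact: bv.
have bwn n : bX (iter n (Pop P sigma) w) by exact: (markov_bX (mPn n)).
have w0 x : 0 <= w x by rewrite subr_ge0.
have step n : exists2 t, policies Gam t &
    forall x, v sigma x + beta ^+ n * iter n (Pop P sigma) w x <= v t x.
  elim: n => [|n [t tG tge]].
    by exists s0 => // x; rewrite expr0 mul1r /= /w /= addrC subrK.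
  (* One step of [sigma] followed by [t] earns at least the [sigma]-return of the lower bound for
     [v t], which is that bound with [n.+1] in place of [n]. *)
  have [t' [t'G _ t'T]] := policy_switch tG sigmaP.
  exists t'; [exact: t'G|move=> x; apply: le_trans (t'T x)].
  rewrite vE// -addrA lerD2l exprS -mulrA -mulrDr ler_wpM2l ?(ltW b0)//.
  have bs : bX (fun x => beta ^+ n * iter n (Pop P sigma) w x) by exact: bX_scale.
  rewrite iterS -[X in _ + X](congr1 (@^~ x) (markovZ (mP sigma) (beta ^+ n) (bwn n))).
  rewrite -[leLHS](congr1 (@^~ x) (markovD (mP sigma) (bv sigmaP) bs)).
  by apply: (markov_le (mP sigma)) => //; [apply: bX_add => //|]; exact: bv.
have wE : w = fun=> 0.
  apply: (@irreducible_eq0 R X (Pop P sigma) rho) => // n.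
  have [t tG tge] := step n.
  have bs : bX (fun x => beta ^+ n * iter n (Pop P sigma) w x) by exact: bX_scale.
  (* Maximality of [sigma] in mean forces the mean of the surplus to be at most 0. *)
  have := le_trans (mean_le rho (bX_add (bv sigmaP) bs) (bv tG) tge) (rhomax t tG).
  rewrite meanD ?meanZ//; last exact: bv.
  rewrite gerDl pmulr_rle0 ?exprn_gt0// => le0; apply/eqP; rewrite eq_le le0/=.
  rewrite -[leLHS](mean_cst rho 0) -(markov_cst 0 (mPn n)).
  have b0' := @bX_cst R X 0; apply: mean_le => //; first exact: (markov_bX (mPn n)).
  exact: (markov_le (mPn n)).
(* As [v s0 = v sigma], the one-step return of [s] is at most [v sigma], which is thus a
   supersolution for [s]. *)
apply: (ge_value bX_all (mP s) b01 (br sG)); first exact: bv.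
move=> x; apply: le_trans (s0T x) _.
by have := congr1 (@^~ x) wE; rewrite /w /= => /eqP; rewrite subr_eq0 => /eqP ->.
Qed.

Lemma optimal_dominates : (forall x, v sigma x = vstar Gam r beta P x) <->
  forall s, policies Gam s -> forall x, v s x <= v sigma x.
Proof.
have [M MP] := rM; have /andP[b0 b1] := b01.
(* A bound common to all policies, needed for [sup] to be a least upper bound; this constant is a
   supersolution for each of them. *)
have vM s x : policies Gam s -> v s x <= `|M| / (1 - beta).
  move=> sG; have bm : 0 < 1 - beta by rewrite subr_gt0.
  apply: (ge_value bX_all (mP s) b01 (br sG)); first exact: bX_cst.
  move=> y; rewrite (markov_cst _ (mP s)).
  have rle : r (y, s y) <= `|M|.
    apply: le_trans (ler_norm _) _; apply: le_trans (MP (y, s y) (sG.2 y)) _; exact: ler_norm.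
  apply: le_trans (lerD rle (lexx _)) _.
  by rewrite le_eqVlt; apply/orP; left; apply/eqP; field; rewrite gt_eqF.
split=> [vs s sG x|dom x].
  rewrite vs; apply: ub_le_sup; last by exists s.
  by exists (`|M| / (1 - beta)) => _ [t tG <-]; exact: vM.
apply/eqP; rewrite eq_le; apply/andP; split.
  apply: ub_le_sup; last by exists sigma.
  by exists (`|M| / (1 - beta)) => _ [t tG <-]; exact: vM.
apply: ge_sup; first by exists (v sigma x); exists sigma.
by move=> _ [t tG <-]; exact: dom.
Qed.

Lemma optimality_equivalences : strongly_irreducible P sigma ->
  [/\ ((exists x : X, forall s, policies Gam s -> v s x <= v sigma x) <->
       (exists rho : probability (borel X) R, forall s, policies Gam s ->
           (\int[rho]_x (v s x)%:E <= \int[rho]_x (v sigma x)%:E)%E)),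
      ((exists rho : probability (borel X) R, forall s, policies Gam s ->
           (\int[rho]_x (v s x)%:E <= \int[rho]_x (v sigma x)%:E)%E) <->
       (forall x, v sigma x = vstar Gam r beta P x)) &
      ((forall x, v sigma x = vstar Gam r beta P x) <->
       (exists x : X, forall s, policies Gam s -> v s x <= v sigma x))].
Proof.
move=> irr.
set E1 := exists x, _; set E2 := exists rho, _; set E3 := forall x, _ = _.
have E12 : E1 -> E2.
  move=> [x xP]; exists \d_(x : borel X) => s sG.
  have dE t : policies Gam t -> (\int[\d_(x : borel X)]_y (v t y)%:E = (v t x)%:E)%E.
    move=> tG; have mv : measurable_fun setT (EFin \o (v t : borel X -> R)).
      by apply/measurable_EFinP; exact: (bv tG).1.
    by rewrite (integral_dirac (x : borel X) measurableT mv) diracT mul1e.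
  by rewrite !dE// lee_fin xP.
have E23 : E2 -> E3.
  move=> [rho rhoP]; apply/optimal_dominates; apply: (mean_maximal_dominates (rho := rho) irr).
  move=> s sG; have := rhoP s sG.
  by rewrite !mean_fin ?lee_fin//; exact: bv.
have E31 : E3 -> E1 by move=> /optimal_dominates dom; exists point => s sG; exact: dom.
by split; split; tauto.
Qed.

End CountableMDP.

(** * Reduction to a countable state space *)

Theorem theorem3p3 (R : realType) (X A : pseudoPMetricType R)
  (hX : hausdorff_space X) (hA : hausdorff_space A)
  (r : X * A -> R) (Gam : X -> set A) (beta : R)
  (P : X * A -> probability (borel X) R) (sigma : X -> A) :
  MDP r Gam beta P ->
  policies Gam sigma ->
  strongly_irreducible P sigma ->
  [/\ ((exists x : X, forall s, policies Gam s ->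
           vpol r beta P s x <= vpol r beta P sigma x) <->
       (exists rho : probability (borel X) R, forall s, policies Gam s ->
           (\int[rho]_x (vpol r beta P s x)%:E <=
            \int[rho]_x (vpol r beta P sigma x)%:E)%E)),
      ((exists rho : probability (borel X) R, forall s, policies Gam s ->
           (\int[rho]_x (vpol r beta P s x)%:E <=
            \int[rho]_x (vpol r beta P sigma x)%:E)%E) <->
       (forall x, vpol r beta P sigma x = vstar Gam r beta P x)) &
      ((forall x, vpol r beta P sigma x = vstar Gam r beta P x) <->
       (exists x : X, forall s, policies Gam s ->
           vpol r beta P s x <= vpol r beta P sigma x))].
Proof.
move=> [b01 [_ Gcomp] [Guhc _] [rM _] Pc] sigmaP irr.
have [ms sG] := sigmaP.
(* Integrals of continuous bounded functions are continuous on the graph, hence Borel along [sigma];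
   this extends to all of [bX]. *)
have mK : markov_operator (Pop P sigma).
  apply: Pop_markov => f; apply: (@measurable_mean R X (fun x => P (x, sigma x))) => u cu.
  exact: (measurable_fun_selector Gcomp Guhc ms sG (Pc _ cu)).
(* The Hausdorff assumption turns the pseudometric into a metric, so singletons are closed. *)
have m1 (x : X) : measurable ([set x] : set (borel X)).
  rewrite -[[set x]]setCK; apply: measurableC; apply: open_borel; apply: closed_openC.
  by apply: accessible_closed_set1; exact: hausdorff_accessible.
have cX := irreducible_countable mK irr m1.
apply: optimality_equivalences => // S.
rewrite (_ : S = \bigcup_(x in S) [set x]).
  apply: countable_bigcup_measurable => //; apply: sub_countable cX; exact: card_leT.
by apply/seteqP; split=> [x Sx|x [y Sy /= ->]//]; exists x.
Qed.
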